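(* Let $(X,\mathcal{R})$ be an imprimitive symmetric association scheme with $d=6$ classes which is cometric with respect to the ordering $E_0,E_1,\dots,E_6$ of its primitive idempotents, with first multiplicity $m=m_1>2$. Then it is impossible that its Krein array is $$\{b_0^*,\dots,b_5^*;c_1^*,\dots,c_6^*\}=\{m,m-1,1,b_3^*,b_4^*,1;\ 1,c_2^*,m-b_3^*,1,c_5^*,m\}$$ with $a_2^*=a_4^*+a_5^*$. In particular, every imprimitive cometric symmetric association scheme (with $d$ classes and $Q$-polynomial ordering $E_0,\dots,E_d$) with first multiplicity $m>2$ is $Q$-bipartite or $Q$-antipodal.
   Context: A symmetric association scheme with $d$ classes is a pair $(X,\mathcal{R})$, $X$ finite, $\mathcal{R}=\{R_0,\dots,R_d\}$ symmetric relations with adjacency matrices $A_i$ such that $A_0=I$, $\sum_i A_i=J$, and each $A_iA_j$ is a linear combination of the $A_h$. Its Bose–Mesner algebra has primitive idempotents $E_0=\frac{1}{|X|}J,E_1,\dots,E_d$; the Krein parameters $q_{ij}^h$ are defined by $E_i\circ E_j=\frac{1}{|X|}\sum_h q_{ij}^hE_h$ ($\circ$ = entrywise product), and $m_i=\mathrm{rank}(E_i)$. The scheme is imprimitive if some graph $(X,R_i)$, $1\le i\le d$, is disconnected. It is cometric ($Q$-polynomial) with respect to $E_0,\dots,E_d$ if $q_{ij}^h=0$ whenever $i+j<h$ and $q_{ij}^h\neq0$ whenever $i+j=h$. In that case set $m=m_1$, $a_i^*=q_{1i}^i$, $b_i^*=q_{1,i+1}^i$, $c_i^*=q_{1,i-1}^i$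 (so $a_i^*+b_i^*+c_i^*=m$); the Krein array is $\{b_0^*,\dots,b_{d-1}^*;c_1^*,\dots,c_d^*\}$. The scheme is $Q$-bipartite if $a_i^*=0$ for all $0\le i\le d$, and $Q$-antipodal if $b_i^*=c_{d-i}^*$ for all $0\le i\le d$ except possibly $i=\lfloor d/2\rfloor$. *)

(* Defs.v *)
From HB Require Import structures.
From mathcomp Require Import all_boot all_order all_algebra all_field.
Set Implicit Arguments. Unset Strict Implicit. Unset Printing Implicit Defensive.
Import Order.TTheory GRing.Theory Num.Theory.
Local Open Scope ring_scope.

(* Vertex set X = 'I_n; the relation containing (x,y) is R_(rel x y),
   relation indices in 'I_(d.+1). Matrices over algC. *)

Section Scheme.
Variables (n d : nat).
Implicit Types (rel : 'I_n -> 'I_n -> 'I_(d.+1)).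

Definition adj rel (i : 'I_(d.+1)) : 'M[algC]_n :=
  \matrix_(x, y) ((rel x y == i)%:R).

Definition in_BM rel (M : 'M[algC]_n) : Prop :=
  exists c : 'I_(d.+1) -> algC, M = \sum_i c i *: adj rel i.

Definition sym_assoc_scheme rel : Prop :=
  [/\ (forall x y, (rel x y == ord0) = (x == y)),
      (forall x y, rel x y = rel y x),
      (forall i, exists x y, rel x y = i) &
      (forall i j, in_BM rel (adj rel i *m adj rel j))].

Definition idem_in_BM rel (F : 'M[algC]_n) : Prop :=
  in_BM rel F /\ F *m F = F.

Definition primitive_idem rel (E : 'M[algC]_n) : Prop :=
  [/\ idem_in_BM rel E, E != 0 &
      ~ (exists F G, [/\ idem_in_BM rel F, idem_in_BM rel G, F != 0, G != 0 &
                        F *m G = 0 /\ E = F + G])].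

Definition prim_idem_ordering rel (E : 'I_(d.+1) -> 'M[algC]_n) : Prop :=
  [/\ injective E, (forall i, primitive_idem rel (E i)),
      (forall F, primitive_idem rel F -> exists i, F = E i) &
      E ord0 = n%:R^-1 *: const_mx 1].

Definition hadamard (M N : 'M[algC]_n) : 'M[algC]_n :=
  \matrix_(x, y) (M x y * N x y).

Definition krein_params (E : 'I_(d.+1) -> 'M[algC]_n)
    (q : 'I_(d.+1) -> 'I_(d.+1) -> 'I_(d.+1) -> algC) : Prop :=
  forall i j, hadamard (E i) (E j) = n%:R^-1 *: \sum_h q i j h *: E h.

Definition imprimitive rel : Prop :=
  exists i : 'I_(d.+1), i != ord0 /\
    exists x y, ~~ connect (fun u v => rel u v == i) x y.
End Scheme.

Section Krein.
Variable d : nat.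
Variable q : 'I_(d.+1) -> 'I_(d.+1) -> 'I_(d.+1) -> algC.

Definition cometric : Prop :=
  forall i j h : 'I_(d.+1),
    ((i + j < h)%N -> q i j h = 0) /\ ((i + j)%N = h -> q i j h != 0).

Definition qn (i j h : nat) : algC := q (inord i) (inord j) (inord h).
Definition astar (i : nat) : algC := qn 1 i i.
Definition bstar (i : nat) : algC := if (i < d)%N then qn 1 i.+1 i else 0.
Definition cstar (i : nat) : algC := if (0 < i)%N then qn 1 i.-1 i else 0.

Definition Q_bipartite : Prop := forall i, (i <= d)%N -> astar i = 0.
Definition Q_antipodal : Prop :=
  forall i, (i <= d)%N -> i != d./2 -> bstar i = cstar (d - i).
End Krein.

(* Main.v *)
(* Write [V_i] for the image of [E_i], viewed as a space of functions on the point
   set. By the tensor criterion, [q_ij^h = 0] iff the pointwise product [V_i V_j] is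
   orthogonal to [V_h]. If some [R_i] is disconnected, the [j] such that [V_j]
   consists of functions constant on its components form a nontrivial set [T] closed
   under products, and [T] does not contain [1].

   If [t] is in [T] and [0 < t < d], and [2] is not in [T], then [V_t V_t] is
   orthogonal to [V_1] and [V_2], so multiplication is a scaled isometry from
   [V_1 (x) V_t] onto [V_(t-1) + V_(t+1)]. Associativity of the product makes both
   summands stable under [so(V_1)]; when [m > 2] this Lie algebra generates
   [End(V_1)], which forces one summand to vanish, a contradiction. Only
   [q_tt^1 = q_tt^2 = 0] is used, and for [t = 3] this already follows from the
   exceptional array. Hence either [T = {0, d}], and the scheme is [Q]-antipodal,
   or [2] is in [T]. In the latter case [a_2 = 0], and Dickie's theorem gives
   [a_1 = 0] if [d >= 3], from which all [a_i] vanish. *)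
Require Import Defs.
From HB Require Import structures.
From mathcomp Require Import all_boot all_order all_algebra all_field.
From mathcomp Require Import ring zify.
Import Order.TTheory GRing.Theory Num.Theory.
Local Open Scope ring_scope.

(** In a full-rank factorization [A = C *m B], idempotency cancels to [B *m C = 1], and the trace is
    cyclic. *)
Lemma mxtrace_idem (F : fieldType) n (A : 'M[F]_n) :
  A *m A = A -> \tr A = (\rank A)%:R.
Proof.
move=> AA; move: (row_base_free A) (col_base_full A).
move: (col_base A) (row_base A) (mulmx_base A) => C B BC B_free /row_fullP[L LC].
suff CB : B *m C = 1%:M by rewrite -{1}BC mxtrace_mulC CB mxtrace1.
apply: (row_free_inj B_free); rewrite mul1mx -[LHS]mul1mx -[RHS]mul1mx -LC.
rewrite -!mulmxA; congr (L *m _).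
by rewrite BC mulmxA BC AA.
Qed.

Lemma sum_sqr_eq0 (I J : finType) (f : I -> J -> algC) :
  (forall i j, f i j \is Num.real) -> \sum_i \sum_j f i j ^+ 2 = 0 ->
  forall i j, f i j = 0.
Proof.
move=> fR /eqP; rewrite psumr_eq0 => [/allP f0 i j|i _]; last first.
  by apply: sumr_ge0 => j _; rewrite real_exprn_even_ge0.
have := f0 i (mem_index_enum _); rewrite psumr_eq0 => [/allP fi0|k _].
  by have := fi0 j (mem_index_enum _); rewrite sqrf_eq0 => /eqP.
by rewrite real_exprn_even_ge0.
Qed.

(** * Pointwise products *)

Section Multiplication.
Variable n : nat.
Implicit Types (u v : 'cV[algC]_n) (M N : 'M[algC]_n).

(** Pointwise multiplication by [v] as an operator: [E h *m diagc (E i *m v) *m E j] multiplies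
    [V_j] by an element of [V_i] and projects to [V_h]. *)
Definition diagc v : 'M[algC]_n := diag_mx v^T.

Lemma diagc_mulE p v (M : 'M[algC]_(n, p)) x y : (diagc v *m M) x y = v x 0 * M x y.
Proof. by rewrite mul_diag_mx !mxE. Qed.

Lemma mul_diagcE v M x y : (M *m diagc v) x y = M x y * v y 0.
Proof. by rewrite mul_mx_diag !mxE. Qed.

Lemma tr_diagc v : (diagc v)^T = diagc v.
Proof. exact: tr_diag_mx. Qed.

Lemma diagcC u v : diagc u *m diagc v = diagc v *m diagc u.
Proof. exact: diag_mxC. Qed.

Lemma diagc_linear : linear diagc.
Proof. by move=> a u v; rewrite /diagc !linearP. Qed.
HB.instance Definition _ := GRing.isLinear.Build algC 'cV[algC]_n 'M[algC]_n _ diagc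
  diagc_linear.

Lemma diagc_mulC u v : diagc u *m v = diagc v *m u.
Proof. by apply/matrixP => x y; rewrite !diagc_mulE !ord1 mulrC. Qed.

Lemma diagcM u v : diagc u *m diagc v = diagc (diagc u *m v).
Proof.
apply/matrixP => x y; rewrite diagc_mulE /diagc mul_diag_mx !mxE.
by rewrite mulrnAr.
Qed.

Lemma diagc_const a : diagc (const_mx a) = a%:M.
Proof. by rewrite /diagc trmx_const diag_const_mx. Qed.

Lemma diagc_delta M v : diagc (M *m v) = \sum_x v x 0 *: diagc (col x M).
Proof.
have ->: M *m v = \sum_x v x 0 *: col x M.
  apply/matrixP => y z; rewrite ord1 mxE summxE; apply: eq_bigr => x _.
  by rewrite !mxE mulrC.
by rewrite linear_sum; apply: eq_bigr => x _; rewrite linearZ.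
Qed.

Lemma trace_sqr M : \tr (M *m M^T) = \sum_x \sum_y M x y ^+ 2.
Proof. by apply: eq_bigr => x _; rewrite mxE; apply: eq_bigr => y _; rewrite mxE. Qed.

Lemma hadamardA M N P : hadamard (hadamard M N) P = hadamard M (hadamard N P).
Proof. by apply/matrixP => x y; rewrite !mxE mulrA. Qed.

Lemma hadamardC M N : hadamard M N = hadamard N M.
Proof. by apply/matrixP => x y; rewrite !mxE mulrC. Qed.

Lemma hadamard_linear M : linear (hadamard M).
Proof. by move=> a u v; apply/matrixP => x y; rewrite !mxE mulrDr mulrCA. Qed.
HB.instance Definition _ M := GRing.isLinear.Build algC 'M[algC]_n 'M[algC]_n _ (hadamard M)
  (hadamard_linear M).
End Multiplication.
Arguments diagc {n}.

(** * Primitive idempotents and Krein parameters *)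

Section Scheme.
Variables (n d : nat) (rel : 'I_n -> 'I_n -> 'I_d.+1).
Variables (E : 'I_d.+1 -> 'M[algC]_n) (q : 'I_d.+1 -> 'I_d.+1 -> 'I_d.+1 -> algC).
Hypothesis scheme_rel : sym_assoc_scheme rel.
Hypothesis ordering_E : prim_idem_ordering rel E.
Hypothesis krein_q : krein_params E q.

Lemma BM_entry M : in_BM rel M -> exists e, forall x y, M x y = e (rel x y).
Proof.
case=> c ->; exists c => x y; rewrite summxE (bigD1 (rel x y)) //= big1.
  by rewrite !mxE eqxx mulr1 addr0.
by move=> i ne_i; rewrite !mxE eq_sym (negPf ne_i) mulr0.
Qed.

Lemma BM_tr M : in_BM rel M -> M^T = M.
Proof.
have [_ relC _ _] := scheme_rel.
by move=> /BM_entry[e eM]; apply/matrixP => x y; rewrite mxE !eM relC.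
Qed.

Lemma BM_lin a M N : in_BM rel M -> in_BM rel N -> in_BM rel (a *: M + N).
Proof.
move=> [b ->] [c ->]; exists (fun i => a * b i + c i).
rewrite scaler_sumr -big_split; apply: eq_bigr => i _ /=.
by rewrite scalerA scalerDl.
Qed.

Lemma BM0 : in_BM rel 0.
Proof. by exists (fun=> 0); rewrite big1 // => i _; rewrite scale0r. Qed.

Lemma BMZ a M : in_BM rel M -> in_BM rel (a *: M).
Proof. by move=> bM; rewrite -[_ *: _]addr0; apply: BM_lin bM BM0. Qed.

Lemma BM_sum I (r : seq I) (P : pred I) (F : I -> 'M[algC]_n) :
  (forall i, in_BM rel (F i)) -> in_BM rel (\sum_(i <- r | P i) F i).
Proof.
move=> bF; apply: big_ind => //; first exact: BM0.
by move=> M N bM bN; rewrite -[M]scale1r; apply: BM_lin.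
Qed.

Lemma BM_mul M N : in_BM rel M -> in_BM rel N -> in_BM rel (M *m N).
Proof.
have [_ _ _ bmul] := scheme_rel.
move=> [b ->] [c ->]; rewrite mulmx_suml; apply: BM_sum => i.
rewrite mulmx_sumr; apply: BM_sum => j.
by rewrite -scalemxAl -scalemxAr; do 2![apply: BMZ].
Qed.

Lemma BM_mulC M N : in_BM rel M -> in_BM rel N -> M *m N = N *m M.
Proof.
move=> bM bN; rewrite -[LHS](BM_tr (M *m N) (BM_mul _ _ bM bN)) trmx_mul.
by rewrite !BM_tr.
Qed.

Lemma BM1 : in_BM rel 1%:M.
Proof.
have [rel0 _ _ _] := scheme_rel; exists (fun i => (i == ord0)%:R).
rewrite (bigD1 ord0) //= big1 ?addr0 => [|i /negPf->]; last by rewrite scale0r.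
by rewrite scale1r; apply/matrixP => x y; rewrite !mxE rel0.
Qed.

Lemma BM_conj M : in_BM rel M -> in_BM rel (map_mx Num.conj M).
Proof.
case=> c ->; exists (fun i => (c i)^*); apply/matrixP => x y.
rewrite !(mxE, summxE) rmorph_sum; apply: eq_bigr => i _.
by rewrite !mxE rmorphM /= rmorph_nat.
Qed.

Lemma idem_BM i : in_BM rel (E i).
Proof. by have [_ /(_ i)[[bE _] _ _] _ _] := ordering_E. Qed.

Lemma idem_idem i : E i *m E i = E i.
Proof. by have [_ /(_ i)[[_ EE] _ _] _ _] := ordering_E. Qed.

Lemma idem_neq0 i : E i != 0.
Proof. by have [_ /(_ i)[_ nzE _] _ _] := ordering_E. Qed.

Lemma idem_tr i : (E i)^T = E i.
Proof. exact/BM_tr/idem_BM. Qed.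

Lemma idem_sym i x y : E i x y = E i y x.
Proof. by rewrite -[in LHS](idem_tr i) mxE. Qed.

(** [F *m N] and [F - F *m N] are orthogonal idempotents with sum [F], so primitivity kills one of
    them. *)
Lemma primitive_mul F N : primitive_idem rel F -> idem_in_BM rel N ->
  F *m N = 0 \/ F *m N = F.
Proof.
move=> [[bF FF] _ splF] [bN NN].
have FN := BM_mulC F N bF bN.
have G_idem : idem_in_BM rel (F *m N).
  split; first exact: BM_mul.
  by rewrite mulmxA -[F *m N *m F]mulmxA -FN mulmxA FF -mulmxA NN.
have [->|nz1] := eqVneq (F *m N) 0; first by left.
have [/eqP|nz2] := eqVneq (F - F *m N) 0; first by rewrite subr_eq0 => /eqP; right.
have e1 : F *m (F *m N) = F *m N by rewrite mulmxA FF.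
have e2 : F *m N *m F = F *m N by rewrite FN -mulmxA FF.
case: splF; exists (F *m N), (F - F *m N); split=> //.
  split; first by rewrite addrC -scaleN1r; apply: BM_lin => //; apply: BM_mul.
  have [_ GG] := G_idem.
  by rewrite mulmxBl !mulmxBr FF e1 e2 GG subrr subr0.
have [_ GG] := G_idem.
by rewrite mulmxBr e2 GG subrr addrC subrK.
Qed.

Lemma idem_orth i j : i != j -> E i *m E j = 0.
Proof.
have [injE primE _ _] := ordering_E => ne_ij.
have idE k : idem_in_BM rel (E k) by split; [apply: idem_BM | apply: idem_idem].
have [// | Ei] := primitive_mul _ _ (primE i) (idE j).
have [|Ej] := primitive_mul _ _ (primE j) (idE i).
  by move=> ji0; rewrite (BM_mulC _ _ (idem_BM i) (idem_BM j)).
case/eqP: ne_ij; apply: injE; rewrite -Ei -[in RHS]Ej.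
by rewrite (BM_mulC _ _ (idem_BM i) (idem_BM j)).
Qed.

Lemma idem_mul i j : E i *m E j = (i == j)%:R *: E i.
Proof.
case: eqVneq => [<-|]; first by rewrite idem_idem scale1r.
by move/idem_orth->; rewrite scale0r.
Qed.

(** The product of [E i] with its conjugate has sums of squared moduli on the diagonal, hence is
    nonzero; by primitivity it equals both factors. *)
Lemma idem_conj i : map_mx Num.conj (E i) = E i.
Proof.
have [_ primE _ _] := ordering_E.
have bC := BM_conj (E i) (idem_BM i).
have CC : map_mx Num.conj (E i) *m map_mx Num.conj (E i) = map_mx Num.conj (E i).
  by rewrite -map_mxM idem_idem.
have [/matrixP Ei0|EC] := primitive_mul _ _ (primE i) (conj bC CC).
  case/eqP: (idem_neq0 i); apply/matrixP => x y; have := Ei0 x x.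
  rewrite !mxE => /eqP; rewrite psumr_eq0 => [/allP/(_ y (mem_index_enum _))|z _].
    by rewrite mxE [E i y x]idem_sym mul_conjC_eq0 => /eqP.
  by rewrite mxE [E i z x]idem_sym mul_conjC_ge0.
by rewrite -{1}EC map_mxM map_mxCK BM_mulC //; apply: idem_BM.
Qed.

Lemma idem_real i x y : E i x y \is Num.real.
Proof. by rewrite CrealE; have /matrixP/(_ x y) := idem_conj i; rewrite mxE => ->. Qed.

(** There are as many idempotents as adjacency matrices, and orthogonality makes them independent,
    so the square coefficient matrix [P] is invertible. *)
Lemma BM_idem_span M : in_BM rel M -> exists c, M = \sum_i c i *: E i.
Proof.
have /fin_all_exists[p pE] : forall i, exists c, E i = \sum_j c j *: adj rel j.
  exact: idem_BM.
pose P := \matrix_(i, j) p i j.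
have P_free : row_free P.
  apply: inj_row_free => v vP; apply/rowP => k; rewrite mxE.
  have vE : \sum_i v 0 i *: E i = 0.
    under eq_bigr => i _ do rewrite pE scaler_sumr.
    rewrite exchange_big big1 //= => j _; under eq_bigr do rewrite scalerA.
    rewrite -scaler_suml; have /rowP/(_ j) := vP; rewrite !mxE.
    by under eq_bigr do rewrite mxE; move->; rewrite scale0r.
  have /eqP := congr1 (mulmx^~ (E k)) vE.
  rewrite /= mul0mx mulmx_suml (bigD1 k) //= big1 => [|i ne_i]; last first.
    by rewrite -scalemxAl idem_orth // scaler0.
  by rewrite addr0 -scalemxAl idem_idem scaler_eq0 (negPf (idem_neq0 k)) orbF => /eqP.
have P_unit : P \in unitmx by rewrite -row_free_unit.
case=> c ->; exists (fun i => (\row_j c j *m invmx P) 0 i).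
under [RHS]eq_bigr => i _ do rewrite pE scaler_sumr.
rewrite exchange_big; apply: eq_bigr => j _ /=; under eq_bigr do rewrite scalerA.
rewrite -scaler_suml; congr (_ *: _).
have /rowP/(_ j) := mulmxKV P_unit (\row_j c j).
by rewrite !mxE => <-; apply: eq_bigr => i _; rewrite [P i j]mxE.
Qed.

Lemma sum_idem : \sum_i E i = 1%:M.
Proof.
have [c c1] := BM_idem_span _ BM1; rewrite c1; apply: eq_bigr => i _.
rewrite -{1}[E i]mulmx1 c1 mulmx_sumr (bigD1 i) //= big1 => [|j ne_j].
  by rewrite addr0 -scalemxAr idem_idem.
by rewrite -scalemxAr idem_orth ?scaler0 // eq_sym.
Qed.

Lemma order_neq0 : n%:R != 0 :> algC.
Proof.
rewrite pnatr_eq0; apply: contra_neqN (idem_neq0 ord0) => /eqP n0.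
by apply/matrixP => x; have := ltn_ord x; rewrite {2}n0.
Qed.

Lemma idem0 : E ord0 = n%:R^-1 *: const_mx 1.
Proof. by have [_ _ _] := ordering_E. Qed.

Lemma idem_diag i x : E i x x = \tr (E i) / n%:R.
Proof.
have [rel0 _ _ _] := scheme_rel; have [e eE] := BM_entry _ (idem_BM i).
have r0 y : rel y y = ord0 by apply/eqP; rewrite rel0.
rewrite /mxtrace; under eq_bigr => y _ do rewrite eE r0.
by rewrite eE r0 sumr_const card_ord -[e _ *+ _]mulr_natr mulfK // order_neq0.
Qed.

Lemma idem_mulE i u v : \sum_x E i x u * E i x v = E i u v.
Proof.
rewrite -[in RHS](idem_idem i) mxE.
by apply: eq_bigr => x _; rewrite [E i x u]idem_sym.
Qed.


Local Notation mu i := (\tr (E i)).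

Lemma mu_rank i : mu i = (\rank (E i))%:R.
Proof. exact/mxtrace_idem/idem_idem. Qed.

Lemma mu_gt0 i : 0 < mu i.
Proof. by rewrite mu_rank ltr0n lt0n mxrank_eq0 idem_neq0. Qed.

Lemma mu_neq0 i : mu i != 0.
Proof. exact/lt0r_neq0/mu_gt0. Qed.

Lemma mu0 : mu ord0 = 1.
Proof.
rewrite idem0 mxtraceZ /mxtrace; under eq_bigr do rewrite mxE.
by rewrite sumr_const card_ord mulVf // order_neq0.
Qed.

Lemma idem_inj a b i : a *: E i = b *: E i -> a = b.
Proof.
move/eqP; rewrite -subr_eq0 -scalerBl scaler_eq0 (negPf (idem_neq0 i)) orbF.
by rewrite subr_eq0 => /eqP.
Qed.

(** * Krein parameters: symmetry, associativity, nonnegativity *)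

Lemma krein_mul i j h : hadamard (E i) (E j) *m E h = (q i j h / n%:R) *: E h.
Proof.
rewrite krein_q -scalemxAl mulmx_suml (bigD1 h) //= big1 => [|k ne_kh].
  by rewrite addr0 -scalemxAl idem_idem scalerA mulrC.
by rewrite -scalemxAl idem_orth ?scaler0.
Qed.

Lemma kreinC i j h : q i j h = q j i h.
Proof.
apply: (mulIf (invr_neq0 order_neq0)); apply: (idem_inj _ _ h).
by rewrite -!krein_mul hadamardC.
Qed.

Lemma krein_trace i j h :
  q i j h / n%:R * mu h = \sum_x \sum_y E i x y * E j x y * E h x y.
Proof.
rewrite -mxtraceZ -krein_mul; apply: eq_bigr => x _; rewrite mxE.
by apply: eq_bigr => y _; rewrite mxE [E h y x]idem_sym.
Qed.

Lemma krein_sym i j h : q i j h * mu h = q i h j * mu j.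
Proof.
apply: (mulIf (invr_neq0 order_neq0)); rewrite ![_ * _ / _]mulrAC !krein_trace.
by apply: eq_bigr => x _; apply: eq_bigr => y _; rewrite mulrAC.
Qed.

Lemma krein_sym_eq0 i j h : (q i j h == 0) = (q i h j == 0).
Proof.
by have := congr1 (eq_op^~ 0) (krein_sym i j h);
  rewrite /= !mulf_eq0 !(negPf (mu_neq0 _)) !orbF.
Qed.

(** Both sides are [n^2] times the coefficient of [E l] in the entrywise product of [E i], [E j] and
    [E k]. *)
Lemma krein_assoc i j k l :
  \sum_h q i j h * q h k l = \sum_h q j k h * q i h l.
Proof.
have nI := invr_neq0 order_neq0.
apply: (mulIf nI); apply: (mulIf nI); apply: (idem_inj _ _ l).
have expand a b c : hadamard (E a) (hadamard (E b) (E c)) *m E l =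
    ((\sum_h q b c h * q a h l) / n%:R / n%:R) *: E l.
  rewrite krein_q linearZ linear_sum -scalemxAl mulmx_suml.
  under eq_bigr do rewrite linearZ -scalemxAl krein_mul scalerA.
  rewrite -scaler_suml scalerA; congr (_ *: _).
  by under eq_bigr do rewrite mulrA; rewrite -mulr_suml mulrC.
under eq_bigr do rewrite [q _ k l]kreinC.
by rewrite -!expand hadamardC hadamardA.
Qed.

Lemma krein_sum i h : \sum_j q i j h = mu i.
Proof.
apply: (mulIf (invr_neq0 order_neq0)); apply: (idem_inj _ _ h).
have <- : hadamard (E i) 1%:M *m E h = (mu i / n%:R) *: E h.
  rewrite -mul_scalar_mx; congr (_ *m _); apply/matrixP => x y; rewrite !mxE.
  by case: eqVneq => [<-|_]; rewrite ?mulr0 ?mulr1 ?mulr0n ?mulr1n ?idem_diag.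
rewrite -sum_idem linear_sum mulmx_suml; under [RHS]eq_bigr do rewrite krein_mul.
by rewrite -scaler_suml mulr_suml.
Qed.

Lemma krein_idem0 j h : q ord0 j h = (j == h)%:R.
Proof.
apply: (mulIf (invr_neq0 order_neq0)); apply: (idem_inj _ _ h).
have e : hadamard (E ord0) (E j) = n%:R^-1 *: E j.
  by apply/matrixP => x y; rewrite idem0 !mxE mulr1.
rewrite -krein_mul e -scalemxAl idem_mul scalerA mulrC.
by case: eqVneq => [->//|_] /=; rewrite mulr0n mul0r !scale0r.
Qed.

Lemma krein_at0 i j : q i j ord0 = (i == j)%:R * mu i.
Proof.
rewrite -[LHS]mulr1 -[X in _ * X = _]mu0 krein_sym kreinC krein_idem0 eq_sym.
by case: eqVneq => [->//|_]; rewrite !mul0r.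
Qed.

(** [E i] is the sum of [v v^T] over its columns [v], and entrywise multiplication by [v v^T] is
    conjugation by [diagc v]. *)
Lemma sum_diag_idem i M :
  \sum_x diagc (col x (E i)) *m M *m diagc (col x (E i)) = hadamard (E i) M.
Proof.
apply/matrixP => u v; rewrite summxE mxE -idem_mulE mulr_suml.
by apply: eq_bigr => x _; rewrite mul_diagcE diagc_mulE !mxE [E i u x]idem_sym
  [E i v x]idem_sym mulrAC.
Qed.

(** Expanding the trace of [hadamard (E i) (E j) *m E h] over the columns of [E i] gives squared
    Frobenius norms of real matrices; nonnegativity and the vanishing criterion both follow. *)
Lemma krein_norm i j h : q i j h / n%:R * mu h =
  \sum_x \sum_u \sum_v (E h *m diagc (col x (E i)) *m E j) u v ^+ 2.
Proof.
rewrite -mxtraceZ -krein_mul -sum_diag_idem mulmx_suml linear_sum.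
apply: eq_bigr => x _; rewrite -trace_sqr !trmx_mul !idem_tr tr_diagc.
rewrite [LHS]mxtrace_mulC !mulmxA -(mulmxA _ (E j) (E j)) idem_idem.
by rewrite [RHS]mxtrace_mulC !mulmxA idem_idem.
Qed.

Lemma krein_entry_real i j h x u v :
  (E h *m diagc (col x (E i)) *m E j) u v \is Num.real.
Proof.
rewrite mxE; apply: rpred_sum => w _; apply: rpredM; last exact: idem_real.
by rewrite mul_diagcE mxE; apply: rpredM; apply: idem_real.
Qed.

Lemma krein_ge0 i j h : 0 <= q i j h.
Proof.
have : 0 <= q i j h / n%:R * mu h.
  rewrite krein_norm; do 3![apply: sumr_ge0 => ? _].
  by rewrite real_exprn_even_ge0 // krein_entry_real.
by rewrite pmulr_lge0 ?mu_gt0 // pmulr_lge0 // invr_gt0 lt0r order_neq0 ler0n.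
Qed.

(* The tensor criterion of Cameron, Goethals and Seidel. *)
Lemma krein_vanish i j h v : q i j h = 0 ->
  E h *m diagc (E i *m v) *m E j = 0.
Proof.
move=> q0; rewrite diagc_delta mulmx_sumr mulmx_suml big1 // => x _.
rewrite -scalemxAr -scalemxAl; apply/eqP; rewrite scaler_eq0; apply/orP; right.
apply/eqP/matrixP => u w; rewrite [RHS]mxE.
have := krein_norm i j h; rewrite q0 !mul0r => /esym/eqP.
rewrite psumr_eq0 => [/allP/(_ x (mem_index_enum _))/eqP x0|? _]; last first.
  do 2![apply: sumr_ge0 => ? _].
  by rewrite real_exprn_even_ge0 // krein_entry_real.
by apply: sum_sqr_eq0 x0 _ _ => *; apply: krein_entry_real.
Qed.


Lemma col_mulmx (M : 'M[algC]_n) x : col x M = M *m (delta_mx x 0 : 'cV[algC]_n).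
Proof. exact: colE. Qed.

Lemma insert_idem (M N : 'M[algC]_n) : M *m N = \sum_h M *m E h *m N.
Proof. by rewrite -mulmx_suml -mulmx_sumr sum_idem mulmx1. Qed.

(** * Idempotents constant on components *)

Section Imprimitive.
Variable i : 'I_d.+1.
Hypothesis i_neq0 : i != ord0.

Definition component_idem j :=
  [forall x, forall y, forall z, (rel x y == i) ==> (E j x z == E j y z)].

Lemma component_idemP j :
  reflect (forall x y z, rel x y = i -> E j x z = E j y z) (component_idem j).
Proof.
apply: (iffP forallP) => [Tj x y z /eqP xy | Tj x].
  by have /forallP/(_ y)/forallP/(_ z)/implyP/(_ xy)/eqP := Tj x.
by apply/forallP => y; apply/forallP => z; apply/implyP => /eqP/Tj->.
Qed.

Lemma component_idem_closed s t h : component_idem s -> component_idem t ->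
  q s t h != 0 -> component_idem h.
Proof.
move=> /component_idemP Ts /component_idemP Tt q_neq0.
apply/component_idemP => x y z xy; have nz : q s t h / n%:R != 0.
  by rewrite mulf_neq0 // invr_neq0 // order_neq0.
have eE u : q s t h / n%:R * E h u z = (hadamard (E s) (E t) *m E h) u z.
  by rewrite krein_mul mxE.
apply: (mulfI nz); rewrite !eE !mxE; apply: eq_bigr => w _; rewrite !mxE.
by rewrite (Ts x y) // (Tt x y).
Qed.

(** Otherwise the identity matrix, being the sum of the idempotents, would have equal rows at two
    distinct points. *)
Lemma component_idem_proper : ~ forall j, component_idem j.
Proof.
move=> T_all; have [rel0 _ rel_onto _] := scheme_rel.
have [x [y xy]] := rel_onto i.
have : (1%:M : 'M[algC]_n) x y = (1%:M : 'M[algC]_n) y y.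
  by rewrite -sum_idem !summxE; apply: eq_bigr => j _; apply/component_idemP: xy.
rewrite !mxE eqxx -rel0 xy (negPf i_neq0) => /esym/eqP.
by rewrite oner_eq0.
Qed.

Lemma adj_BM : in_BM rel (adj rel i).
Proof.
exists (fun k => (k == i)%:R); rewrite (bigD1 i) //= eqxx scale1r big1 ?addr0 //.
by move=> k /negPf->; rewrite scale0r.
Qed.

Lemma adj_idem : exists p : 'I_d.+1 -> algC, forall j, adj rel i *m E j = p j *: E j.
Proof.
have [p ->] := BM_idem_span _ adj_BM; exists p => j.
rewrite mulmx_suml (bigD1 j) //= big1 ?addr0 => [|k kj].
  by rewrite -scalemxAl idem_idem.
by rewrite -scalemxAl idem_orth ?scaler0.
Qed.

Section Valency.
Variable p : 'I_d.+1 -> algC.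
Hypothesis pE : forall j, adj rel i *m E j = p j *: E j.

Lemma valencyE x : \sum_y adj rel i x y = p ord0.
Proof.
have Ap : adj rel i *m const_mx 1 = p ord0 *: (const_mx 1 : 'M[algC]_n).
  apply: (scalerI (invr_neq0 order_neq0)).
  by rewrite scalemxAr -idem0 pE idem0 !scalerA mulrC.
have /matrixP/(_ x x) := Ap; rewrite !mxE mulr1 => <-.
by apply: eq_bigr => y _; rewrite [const_mx _ _ _]mxE mulr1.
Qed.

(* A real function [f] with [A_i f = k f], where [k] is the valency, satisfies
   [sum over edges of (f x - f y)^2 = 2 k |f|^2 - 2 <f, A_i f> = 0]. *)
Lemma valency_component j : p j = p ord0 -> component_idem j.
Proof.
move=> pj; apply/component_idemP => x y z xy; have [_ relC _ _] := scheme_rel.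
have adjC u v : adj rel i u v = adj rel i v u by rewrite !mxE relC.
pose f u := E j u z; set k := p ord0.
have sum_l : \sum_u \sum_v adj rel i u v * f u ^+ 2 = k * \sum_u f u ^+ 2.
  by rewrite mulr_sumr; apply: eq_bigr => u _; rewrite -mulr_suml valencyE.
have sum_r : \sum_u \sum_v adj rel i u v * f v ^+ 2 = k * \sum_u f u ^+ 2.
  rewrite exchange_big -sum_l; apply: eq_bigr => u _.
  by apply: eq_bigr => v _; rewrite adjC.
have sum_m : \sum_u \sum_v adj rel i u v * (f u * f v) = k * \sum_u f u ^+ 2.
  rewrite mulr_sumr; apply: eq_bigr => u _; under eq_bigr do rewrite mulrCA.
  rewrite -mulr_sumr; have /matrixP/(_ u z) := pE j; rewrite pj !mxE => ->.
  by rewrite mulrCA.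
have sum0 : \sum_u \sum_v (adj rel i u v * (f u - f v)) ^+ 2 = 0.
  have -> : \sum_u \sum_v (adj rel i u v * (f u - f v)) ^+ 2 =
      \sum_u \sum_v adj rel i u v * f u ^+ 2
      + \sum_u \sum_v adj rel i u v * f v ^+ 2
      - (\sum_u \sum_v adj rel i u v * (f u * f v)) *+ 2.
    rewrite -sumrMnl -big_split -sumrB; apply: eq_bigr => u _ /=.
    rewrite -sumrMnl -big_split -sumrB; apply: eq_bigr => v _ /=.
    by rewrite !mxE; case: (rel u v == i); rewrite ?mul0r ?mul1r; ring.
  by rewrite sum_l sum_r sum_m mulr2n subrr.
have := sum_sqr_eq0 _ _ (fun u v => adj rel i u v * (f u - f v)) _ sum0 x y.
rewrite mxE xy eqxx mul1r => fxy; apply/subr0_eq/fxy => u v.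
by rewrite mxE rpredM ?rpred_nat // rpredB // idem_real.
Qed.
End Valency.

(** The indicator of a component is an eigenvector of [adj rel i] for the valency. If only [E ord0]
    had that eigenvalue, the indicator would be constant, but it separates [x] from [y]. *)
Lemma component_idem_nontrivial x y :
  ~~ connect (fun u v => rel u v == i) x y ->
  exists2 j, j != ord0 & component_idem j.
Proof.
move=> xy; have [_ relC _ _] := scheme_rel; have [p pE] := adj_idem.
case: (pickP (fun j => (j != ord0) && (p j == p ord0))) => [j|no_j].
  by case/andP=> j0 /eqP pj; exists j => //; apply: valency_component pE _ pj.
pose e u v := rel u v == i; pose chi : 'cV[algC]_n := \col_u (connect e x u)%:R.
have e_sym : connect_sym e.
  by apply: sym_connect_sym => u v; rewrite /e relC.
have Achi : adj rel i *m chi = p ord0 *: chi.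
  apply/matrixP => u v; rewrite !mxE -(valencyE _ pE u) mulr_suml.
  apply: eq_bigr => t _; rewrite !mxE.
  have [ut|] := boolP (rel u t == i); last by rewrite !mul0r.
  by congr (_ * (nat_of_bool _)%:R); rewrite ![connect e x _]e_sym;
     apply/esym/(same_connect e_sym)/connect1.
have chi0 : E ord0 *m chi = chi.
  rewrite -[RHS]mul1mx -sum_idem mulmx_suml (bigD1 ord0) //= big1 ?addr0 //.
  move=> j j0; have /eqP : (p j - p ord0) *: (E j *m chi) = 0.
    rewrite scalerBl scalemxAl -pE scalemxAr -Achi mulmxA.
    by rewrite (BM_mulC _ _ adj_BM (idem_BM j)) subrr.
  by rewrite scaler_eq0 subr_eq0; have := no_j j; rewrite j0 /= => -> /eqP.
have : chi x 0 = chi y 0.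
  rewrite -chi0 idem0 -scalemxAl !mxE; congr (_ * _).
  by apply: eq_bigr => t _; rewrite !mxE.
rewrite !mxE connect0 (negPf xy) => /eqP.
by rewrite oner_eq0.
Qed.
End Imprimitive.

(** * Cometric schemes *)

Section Cometric.
Hypothesis cometric_q : cometric q.

Lemma krein_far (i j h : 'I_d.+1) :
  [|| i + j < h, i + h < j | j + h < i]%N -> q i j h = 0.
Proof.
case/or3P => far; first by have [/(_ far)] := cometric_q i j h.
  by apply/eqP; rewrite krein_sym_eq0; apply/eqP; have [/(_ far)] := cometric_q i h j.
apply/eqP; rewrite kreinC krein_sym_eq0; apply/eqP.
by have [/(_ far)] := cometric_q j h i.
Qed.

Lemma krein_near (i j h : 'I_d.+1) :
  [|| i + j == h, i + h == j | j + h == i]%N -> q i j h != 0.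
Proof.
case/or3P => /eqP near; first by have [_ /(_ near)] := cometric_q i j h.
  by rewrite krein_sym_eq0; have [_ /(_ near)] := cometric_q i h j.
by rewrite kreinC krein_sym_eq0; have [_ /(_ near)] := cometric_q j h i.
Qed.

(** * Multiplication by functions in [V_1] *)

Section FirstIdempotent.
Variable o : 'I_d.+1.
Hypothesis o1 : o = 1%N :> nat.

Implicit Types (u v : 'cV[algC]_n).
Local Notation D v := (diagc (E o *m v)).
Local Notation F x := (diagc (col x (E o))).

Lemma krein1_far (i j : 'I_d.+1) : (i.+1 < j)%N || (j.+1 < i)%N -> q o i j = 0.
Proof. by move=> far; apply: krein_far; rewrite o1 !add1n orbA far. Qed.

Lemma mul_idem_diag (i j : 'I_d.+1) v :
  (i.+1 < j)%N || (j.+1 < i)%N -> E i *m D v *m E j = 0.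
Proof. by move=> far; apply/krein_vanish/krein1_far; rewrite orbC. Qed.

Lemma idem_prod (h : 'I_d.+1) u v : (2 < h)%N -> E h *m (D u *m (E o *m v)) = 0.
Proof.
move=> h3; rewrite !mulmxA mul_idem_diag ?mul0mx //.
by rewrite o1 h3 orbT.
Qed.

Lemma sum_prod u v :
  \sum_y (D u *m (E o *m v)) y 0 = (u^T *m E o *m v) 0 0.
Proof.
have -> : u^T *m E o *m v = (E o *m u)^T *m (E o *m v).
  by rewrite trmx_mul idem_tr !mulmxA -(mulmxA _ (E o) (E o)) idem_idem.
by rewrite [RHS]mxE; apply: eq_bigr => y _; rewrite diagc_mulE [(_^T) _ _]mxE.
Qed.

Lemma idem0_prod u v :
  diagc (E ord0 *m (D u *m (E o *m v))) = ((u^T *m E o *m v) 0 0 / n%:R)%:M.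
Proof.
rewrite -diagc_const -sum_prod; congr diagc; apply/matrixP => x y.
rewrite ord1 [LHS]mxE [RHS]mxE mulrC mulr_sumr; apply: eq_bigr => z _.
rewrite idem0; congr (_ * _).
by rewrite [LHS]mxE [const_mx _ _ _]mxE mulr1.
Qed.

(** [V_1 V_1] lies in [V_0 + V_1 + V_2], and the [V_0] component is the constant given by the inner
    product. *)
Lemma prod_idem u v (w : 'I_d.+1) : w = 2%N :> nat ->
  D u *m D v = ((u^T *m E o *m v) 0 0 / n%:R)%:M
    + D (D u *m (E o *m v)) + diagc (E w *m (D u *m (E o *m v))).
Proof.
move=> w2; have o0 : o != ord0 by rewrite -val_eqE /= o1.
have wo : w != o by rewrite -val_eqE /= o1 w2.
rewrite diagcM -[X in diagc X = _]mul1mx -sum_idem mulmx_suml linear_sum.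
rewrite (bigD1 ord0) //= (bigD1 o) //= (bigD1 w) /=; last first.
  by rewrite wo -val_eqE /= w2.
rewrite big1 => [|h /andP[/andP[h0 ho] hw]]; first by rewrite addr0 addrA idem0_prod.
rewrite idem_prod ?linear0 // ltnNge; apply: contra hw => h2.
by move: h0 ho; rewrite -!val_eqE /= o1 w2; case: (val h) h2 => [|[|[]]].
Qed.

(* The action of [so(V_1)] is used only through sums over the points [x] of terms
   quadratic in [col x (E o)]: these columns resolve the identity of [V_1]. *)
Section Isometric.
Variables t s r : 'I_d.+1.
Hypotheses (st : s.+1 = t) (tr : t.+1 = r).
Hypotheses (tt1 : q t t o = 0)
  (tt2 : forall w : 'I_d.+1, w = 2%N :> nat -> q t t w = 0).

(** Up to the factor [1/n], [g] is the inner product of two columns of [E o]. [S] and [P] lead from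
    [V_t] back to [V_t] by two multiplications, through [V_r] and [V_s] respectively. *)
Local Notation g x y := (E o x y / n%:R).
Local Notation psi x := (E t *m F x *m E r).
Local Notation S x y := (E t *m F x *m E r *m F y *m E t).
Local Notation P x y := (E t *m F x *m E s *m F y *m E t).

(** Of the three terms of [prod_idem], those in [V_1] and [V_2] vanish between two copies of [E t]
    by [tt1] and [tt2]. *)
Lemma isometric_prod x y : E t *m F x *m F y *m E t = g x y *: E t.
Proof.
have w2 : (2 < d.+1)%N by have := ltn_ord r; rewrite -tr -st; apply: leq_ltn_trans.
have q_tt h : q t t h = 0 -> forall v, E t *m diagc (E h *m v) *m E t = 0.
  move=> q0 v; apply: krein_vanish.
  by apply/eqP; rewrite kreinC krein_sym_eq0 q0.
rewrite !col_mulmx -(mulmxA (E t)) (prod_idem _ _ (Ordinal w2)) //.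
rewrite !mulmxDr !mulmxDl (q_tt o) // (q_tt (Ordinal w2)) ?tt2 // !addr0.
rewrite mul_mx_scalar -scalemxAl idem_idem.
by rewrite trmx_delta -rowE -colE !mxE.
Qed.

Lemma split_prod x y : P x y + S x y = g x y *: E t.
Proof.
rewrite -isometric_prod -[RHS]mulmxA [RHS]insert_idem.
have rs : r != s by rewrite -val_eqE /= -tr -st; lia.
rewrite (bigD1 s) //= (bigD1 r) //= big1 ?addr0 ?mulmxA // => h /andP[hs hr].
have [ht|ne_ht] := eqVneq h t.
  rewrite ht !col_mulmx krein_vanish ?mul0mx //.
  by apply/eqP; rewrite kreinC krein_sym_eq0 tt1.
rewrite col_mulmx mul_idem_diag ?mul0mx //.
by move: hs hr ne_ht; rewrite -!val_eqE /= -tr -st; lia.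
Qed.

(** Each multiplication moves the index by at most one, so two steps from [r] to [s] must pass
    through [t]. Commutativity of pointwise multiplication thus survives the insertion of [E t]. *)
Lemma cross_prod x y : E s *m F x *m E t *m F y *m E r = E s *m F x *m F y *m E r.
Proof.
rewrite -[RHS]mulmxA [RHS]insert_idem (bigD1 t) //= big1 ?addr0 ?mulmxA // => h.
rewrite -val_eqE /= => ht; have [th|hlt] := ltnP t h.
  by rewrite [col x _]col_mulmx mul_idem_diag ?mul0mx //; lia.
rewrite -mulmxA (mulmxA (E h)) [col y _]col_mulmx mul_idem_diag ?mulmx0 //; lia.
Qed.

Lemma cross_sym x y :
  E s *m F x *m E t *m F y *m E r = E s *m F y *m E t *m F x *m E r.
Proof. by rewrite !cross_prod -(mulmxA _ (F x)) diagcC mulmxA. Qed.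
Lemma cross_sym_tr x y :
  E r *m F x *m E t *m F y *m E s = E r *m F y *m E t *m F x *m E s.
Proof.
apply: trmx_inj; rewrite !trmx_mul !idem_tr !tr_diagc !mulmxA.
exact: cross_sym.
Qed.

Lemma P_eq x y : P x y = g x y *: E t - S x y.
Proof. by rewrite -split_prod addrK. Qed.

(** By [P_eq] each side is some [P *m psi], whose tail from [V_r] to [V_s] is symmetric in [f] and
    [k] by [cross_sym]. *)
Lemma psi_exchange h f k :
  g h f *: psi k - S h f *m psi k = g h k *: psi f - S h k *m psi f.
Proof.
have Epsi x : E t *m psi x = psi x by rewrite !mulmxA idem_idem.
have Ppsi x y z : P x y *m psi z = E t *m F x *m (E s *m F y *m E t *m F z *m E r).
  by rewrite !mulmxA -(mulmxA _ (E t) (E t)) idem_idem.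
have PE x y z : g x y *: psi z - S x y *m psi z = P x y *m psi z.
  by rewrite P_eq mulmxBl -scalemxAl Epsi.
by rewrite !PE !Ppsi cross_sym.
Qed.

(* Invariance of the form [S] under [so(V_1)]. *)
Lemma S_exchange h f k l :
  g h f *: S k l - g h k *: S f l = g k l *: S h f - g f l *: S h k.
Proof.
have psiS x y : psi x *m (F y *m E t) = S x y by rewrite mulmxA.
have SE x y : S x y *m E t = S x y by rewrite -mulmxA idem_idem.
have e1 : g h f *: S k l - S h f *m S k l = g h k *: S f l - S h k *m S f l.
  have := congr1 (mulmx^~ (F l *m E t)) (psi_exchange h f k).
  by rewrite /= !mulmxBl -!scalemxAl -(mulmxA (S h f)) -(mulmxA (S h k)) !psiS.
have SP x y z w : S x y *m P z w =
    E t *m F x *m (E r *m F y *m E t *m F z *m E s) *m F w *m E t.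
  by rewrite !mulmxA -(mulmxA _ (E t) (E t)) idem_idem.
have e2 : g k l *: S h f - S h f *m S k l = g f l *: S h k - S h k *m S f l.
  have PE x y z w : g z w *: S x y - S x y *m S z w = S x y *m P z w.
    by rewrite P_eq mulmxBr -scalemxAr SE.
  by rewrite !PE !SP cross_sym_tr.
(* [e1] and [e2] contain the same quartic terms, which cancel in their difference. *)
rewrite -[g h f *: _](subrK (S h f *m S k l)) -[g k l *: _](subrK (S h f *m S k l)).
by rewrite e1 e2 [LHS]addrC [RHS]addrC -!addrA !addKr.
Qed.

Lemma sum_gF k : \sum_f g f k *: F f = n%:R^-1 *: F k.
Proof.
rewrite -linearZ; under eq_bigr do rewrite -linearZ; rewrite -linear_sum.
congr diagc; apply/matrixP => z w; rewrite summxE !mxE idem_sym -idem_mulE mulr_sumr.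
by apply: eq_bigr => f _; rewrite !mxE [E o f z]idem_sym mulrAC mulrC [E o f k * _]mulrC.
Qed.

Lemma sum_gdiag : \sum_f g f f = mu o / n%:R.
Proof. by rewrite -mulr_suml. Qed.

Lemma sum_S : \sum_f S f f = (q o r t / n%:R) *: E t.
Proof.
have -> : \sum_f S f f = E t *m hadamard (E o) (E r) *m E t.
  by rewrite -sum_diag_idem mulmx_sumr mulmx_suml; under [RHS]eq_bigr do rewrite !mulmxA.
by rewrite -mulmxA krein_mul -scalemxAr idem_idem.
Qed.

Lemma sum_gF_mul (M N : 'M[algC]_n) k :
  \sum_f g f k *: (M *m F f *m N) = n%:R^-1 *: (M *m F k *m N).
Proof.
rewrite scalemxAl scalemxAr -sum_gF mulmx_sumr mulmx_suml.
by apply: eq_bigr => f _; rewrite -scalemxAr -scalemxAl.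
Qed.

(** This is [S_exchange] at [h = f], summed over all points [f]. *)
Lemma S_contract k l :
  (mu o - 1) *: S k l + S l k = (q o r t * g k l) *: E t.
Proof.
have Sl x y : S x y = E t *m F x *m (E r *m F y *m E t) by rewrite !mulmxA.
have sumS x y : \sum_f g f x *: S f y = n%:R^-1 *: S x y.
  by under eq_bigr do rewrite Sl; rewrite sum_gF_mul -Sl.
have : \sum_f (g f f *: S k l - g f k *: S f l) =
       \sum_f (g k l *: S f f - g f l *: S f k).
  by apply: eq_bigr => f _; apply: S_exchange.
rewrite !sumrB -scaler_suml -scaler_sumr sum_gdiag sum_S !sumS.
move: (E t) (S l k) (S k l) => C B A /matrixP ABC.
apply/matrixP => u v; have := ABC u v; rewrite !mxE.
move: (mu o) (q o r t) (E o k l) (A u v) (B u v) (C u v) => m b e a1 a2 c H.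
apply/eqP; rewrite -subr_eq0; apply/eqP.
transitivity (n%:R * (m / n%:R * a1 - n%:R^-1 * a1 -
  (e / n%:R * (b / n%:R * c) - n%:R^-1 * a2))).
  by field; apply: order_neq0.
by rewrite H subrr mulr0.
Qed.

(** Swapping [k] and [l] in [S_contract] and subtracting shows that [mu o - 2] times [S k l - S l k]
    is zero, so [S] is symmetric. *)
Lemma S_diag k l : mu o != 2 -> mu o *: S k l = (q o r t * g k l) *: E t.
Proof.
move=> mu2; have := S_contract l k; rewrite idem_sym; have := S_contract k l.
move: (E t) (S l k) (S k l) => C B A <-.
move/eqP; rewrite -subr_eq0 => /eqP AB.
suff -> : B = A by rewrite scalerBl scale1r subrK.
apply/eqP; rewrite -subr_eq0; have : (mu o - 2) *: (B - A) = 0.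
  rewrite -[RHS]AB; apply/matrixP => u v; rewrite !mxE; ring.
by move/eqP; rewrite scaler_eq0 !subr_eq0 (negPf mu2).
Qed.

(** [S] is now a multiple of [g]. Contracting [psi_exchange] gives [(m - 1) q_1s^t psi = 0], so
    [psi] vanishes, and [sum_S] then contradicts [q_1r^t != 0]. *)
Lemma isometric_absurd : mu o != 1 -> mu o != 2 -> False.
Proof.
move=> mu1 mu2; have mu_n0 := mu_neq0 o.
have q_r : q o r t != 0 by apply: krein_near; rewrite o1 !add1n tr eqxx !orbT.
have q_s : q o s t != 0 by apply: krein_near; rewrite o1 !add1n st eqxx.
have q_t : q o t t = 0 by apply/eqP; rewrite kreinC krein_sym_eq0 tt1.
have mu_qs : mu o = q o s t + q o r t.
  rewrite -(krein_sum o t) (bigD1 s) //= (bigD1 r) /=; last first.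
    by rewrite -val_eqE /= -tr -st; lia.
  rewrite big1 ?addr0 // => h /andP[hs hr].
  have [->//|ht] := eqVneq h t; apply: krein1_far.
  by move: hs hr ht; rewrite -!val_eqE /= -tr -st; lia.
have S_eq x y : S x y = (q o r t / mu o * g x y) *: E t.
  apply: (scalerI mu_n0); rewrite S_diag // scalerA; congr (_ *: _).
  by field; rewrite order_neq0.
have psi0 k : psi k = 0.
  have Epsi x : E t *m psi x = psi x by rewrite !mulmxA idem_idem.
  have : \sum_f (g f f *: psi k - S f f *m psi k) =
         \sum_f (g f k *: psi f - S f k *m psi f).
    by apply: eq_bigr => f _; apply: psi_exchange.
  rewrite !sumrB -scaler_suml sum_gdiag -mulmx_suml sum_S sum_gF_mul.
  under [in RHS]eq_bigr do rewrite S_eq -scalemxAl Epsi -scalerA.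
  rewrite -scaler_sumr sum_gF_mul -scalemxAl Epsi; move: (psi k) => A AA.
  apply/eqP; have : ((mu o - 1) * q o s t / (n%:R * mu o)) *: A = 0.
    have -> : 0 = (mu o / n%:R) *: A - (q o r t / n%:R) *: A -
        (n%:R^-1 *: A - (q o r t / mu o) *: (n%:R^-1 *: A)).
      by rewrite AA subrr.
    rewrite mu_qs in mu_n0 *; apply/matrixP => u v; rewrite !mxE.
    by field; rewrite mu_n0 order_neq0.
  move/eqP; rewrite scaler_eq0 !mulf_eq0 invr_eq0 mulf_eq0 subr_eq0.
  by rewrite (negPf mu1) (negPf q_s) (negPf mu_n0) (negPf order_neq0).
have := sum_S; rewrite big1 => [/esym/eqP|f _]; last first.
  by rewrite -mulmxA psi0 mul0mx.
rewrite scaler_eq0 (negPf (idem_neq0 t)) orbF mulf_eq0 (negPf q_r) invr_eq0.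
by rewrite (negPf order_neq0).
Qed.
End Isometric.
(* Dickie's theorem. On [V_1] with the Norton product [f * f' = E_1 (f f')],
   multiplication operators by elements of [V_2], compressed to [V_1], commute with
   the Norton multiplications [norton] when [a_2 = 0], hence with each other and
   with the compressions to [V_1] of all products [f f']. The trace of the latter
   commutation gives [c_2 = m], so that [b_2 = 0]. *)
Section Dickie.
Variables w z : 'I_d.+1.
Hypotheses (w2 : w = 2%N :> nat) (z3 : z = 3%N :> nat).
Hypotheses (a2 : q o w w = 0) (a1 : q o o o != 0).

Local Notation norton u := (E o *m D u *m E o).
Local Notation K v := (E o *m diagc (E w *m v) *m E o).
Local Notation P u v := (E o *m D u *m D v *m E o).

Lemma cV_ext (M N : 'M[algC]_n) : (forall v : 'cV[algC]_n, M *m v = N *m v) -> M = N.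
Proof.
move=> MN; apply/matrixP => x y.
by have /matrixP/(_ x 0) := MN (delta_mx y 0); rewrite -!colE !mxE.
Qed.

Lemma nortonC u v : norton u *m v = norton v *m u.
Proof. by rewrite -!mulmxA diagc_mulC. Qed.

(** Inserting the sum of all idempotents between the two multiplications leaves only [E o], since
    [a2] removes [E w]. The product is thus a compressed product of commuting diagonal matrices. *)
Lemma K_norton v u : K v *m norton u = norton u *m K v.
Proof.
have mid : E o *m diagc (E w *m v) *m (D u *m E o) = K v *m norton u.
  rewrite insert_idem (bigD1 o) //= big1 ?addr0.
    by rewrite !mulmxA -(mulmxA _ (E o) (E o)) idem_idem.
  move=> h; rewrite -val_eqE /= o1 => h1.
  have [h3|h2] := ltnP 2 h.
    by rewrite -mulmxA (mulmxA (E h)) mul_idem_diag ?mulmx0 // o1 h3 orbT.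
  rewrite krein_vanish ?mul0mx //.
  have [->|hw] := eqVneq h w; first by apply/eqP; rewrite krein_sym_eq0 kreinC a2.
  by apply: krein_far; rewrite o1 w2; move: h1 h2 hw; rewrite -val_eqE /= w2; lia.
rewrite -mid; apply: trmx_inj; rewrite !trmx_mul !tr_diagc !idem_tr.
move: mid; rewrite !mulmxA => <-.
by rewrite -(mulmxA (E o) (D u)) diagcC mulmxA.
Qed.

Lemma norton_K v u : norton (K v *m u) = K v *m norton u.
Proof.
apply: cV_ext => x; rewrite nortonC [LHS]mulmxA -K_norton -[LHS]mulmxA nortonC.
exact: mulmxA.
Qed.

(** The squares of the Norton multiplications by the columns of [E o] add up to the nonzero scalar
    [a_1 / n] on [V_1]. *)
Lemma norton_nondegenerate u : E o *m u = u -> norton u = 0 -> u = 0.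
Proof.
move=> Eu u0.
have : \sum_x norton (delta_mx x 0) *m norton (delta_mx x 0) *m u = 0.
  rewrite big1 // => x _.
  by rewrite -(mulmxA (norton _)) [norton _ *m u]nortonC u0 mul0mx mulmx0.
have -> : \sum_x norton (delta_mx x 0) *m norton (delta_mx x 0) *m u =
    E o *m hadamard (E o) (E o) *m E o *m u.
  rewrite -sum_diag_idem mulmx_sumr !mulmx_suml; apply: eq_bigr => x _.
  by rewrite -colE !mulmxA -(mulmxA _ (E o) (E o)) idem_idem.
rewrite -(mulmxA (E o)) krein_mul -scalemxAr idem_idem -scalemxAl Eu => /eqP.
by rewrite scaler_eq0 mulf_eq0 (negPf a1) invr_eq0 (negPf order_neq0) => /eqP.
Qed.

(** By [norton_K] and [K_norton], applying [K v] and [K v'] to [u] in either order gives the same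
    Norton multiplication. *)
Lemma K_comm v v' : K v *m K v' = K v' *m K v.
Proof.
apply: cV_ext => u; apply/eqP; rewrite -subr_eq0; apply/eqP.
rewrite -(mulmxA (K v)) -(mulmxA (K v')); apply: norton_nondegenerate.
  by rewrite mulmxBr !mulmxA !idem_idem.
have -> : norton (K v *m (K v' *m u) - K v' *m (K v *m u)) =
    norton (K v *m (K v' *m u)) - norton (K v' *m (K v *m u)).
  by rewrite mulmxBr linearB mulmxBr mulmxBl.
rewrite norton_K norton_K [X in _ - X]norton_K [X in _ - X]K_norton norton_K.
by rewrite -[X in _ - X]mulmxA -K_norton subrr.
Qed.

Lemma P_sym u v x : P u v *m x = P x v *m u.
Proof.
have swap a b : P a b = E o *m D b *m D a *m E o.
  by rewrite -(mulmxA (E o) (D a)) diagcC mulmxA.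
by rewrite (swap u) (swap x) -!mulmxA [D u *m _]diagc_mulC.
Qed.

(** By [prod_idem], [P x v] is a sum of scalar, [norton] and [K] terms on [V_1], all commuting with
    [K c]; [P_sym] then moves [K c] inside. *)
Lemma P_K c u v : P (K c *m u) v = K c *m P u v.
Proof.
have comm x : K c *m P x v = P x v *m K c.
  rewrite -(mulmxA (E o) (D x)) (prod_idem _ _ _ w2) !mulmxDr !mulmxDl.
  rewrite !mulmxDr K_norton K_comm; congr (_ + _ + _).
  by rewrite mul_mx_scalar -scalemxAl idem_idem -scalemxAr -scalemxAl !mulmxA idem_idem
    -(mulmxA _ (E o) (E o)) idem_idem.
apply: cV_ext => x; rewrite P_sym [LHS]mulmxA -comm -[LHS]mulmxA P_sym.
exact: mulmxA.
Qed.

Lemma trace_P u v : \tr (P u v) = mu o / n%:R * (u^T *m E o *m v) 0 0.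
Proof.
rewrite mxtrace_mulC !mulmxA idem_idem -(mulmxA (E o)) diagcM -sum_prod mulr_sumr.
by apply: eq_bigr => y _; rewrite mul_diagcE idem_diag.
Qed.

Lemma K_diag c y : K c y y = q o o w / n%:R * (E w *m c) y 0.
Proof.
have -> : K c y y = (hadamard (E o) (E o) *m (E w *m c)) y 0.
  rewrite !mxE; apply: eq_bigr => x _.
  by rewrite mul_diagcE [hadamard _ _ _ _]mxE [E o x y]idem_sym mulrAC.
by rewrite mulmxA krein_mul -scalemxAl mxE.
Qed.

(** A second evaluation of a trace that [P_K] and [trace_P] give with factor [m / n]; here the
    factor is [c_2 / n], read from the diagonal of [K c]. *)
Lemma trace_KP c u v :
  \tr (K c *m P u v) = q o o w / n%:R * (u^T *m K c *m v) 0 0.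
Proof.
have -> : \tr (K c *m P u v) = \tr (K c *m diagc (D u *m (E o *m v))).
  rewrite -diagcM mulmxA mxtrace_mulC !mulmxA idem_idem.
  by rewrite -(mulmxA _ (E o) (E o)) idem_idem.
have -> : u^T *m K c *m v = (E o *m u)^T *m (diagc (E w *m c) *m (E o *m v)).
  by rewrite trmx_mul idem_tr !mulmxA.
rewrite [in RHS]mxE mulr_sumr; apply: eq_bigr => y _.
by rewrite mul_diagcE K_diag !diagc_mulE [(_^T) _ _]mxE; ring.
Qed.

Lemma dickie_absurd : False.
Proof.
have c2 : q o o w != mu o.
  apply/eqP => c2; have := krein_sum o w.
  rewrite (bigD1 o) //= c2 (bigD1 z) /=; last by rewrite -val_eqE /= o1 z3.
  rewrite big1 ?addr0 => [|h /andP[ho hz]].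
    move/(canRL (addKr _)); rewrite addNr => /eqP; apply/negP.
    by apply: krein_near; rewrite o1 w2 z3.
  have [->//|hw] := eqVneq h w; apply: krein_far.
  by move: ho hz hw; rewrite -!val_eqE /= o1 w2 z3; lia.
have K0 c : K c = 0.
  apply/matrixP => x y; have := trace_KP c (delta_mx x 0) (delta_mx y 0).
  have entry (M : 'M[algC]_n) :
      ((delta_mx x 0 : 'cV[algC]_n)^T *m M *m (delta_mx y 0 : 'cV[algC]_n)) 0 0 = M x y.
    by rewrite trmx_delta -rowE -colE !mxE.
  have -> : \tr (K c *m P (delta_mx x 0) (delta_mx y 0)) = mu o / n%:R * K c x y.
    rewrite -P_K trace_P -[K c x y]entry !trmx_mul !tr_diagc !idem_tr.
    by rewrite !mulmxA -(mulmxA _ (E o) (E o)) idem_idem.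
  rewrite entry => /eqP; rewrite -subr_eq0 -mulrBl -mulrBl !mulf_eq0 invr_eq0.
  by rewrite subr_eq0 eq_sym (negPf c2) (negPf order_neq0) => /eqP ->; rewrite mxE.
(* If every [K] is zero, so is [q_21^1], contrary to [1 + 1 = 2]. *)
have : \sum_x K (delta_mx x 0) *m K (delta_mx x 0) = 0.
  by rewrite big1 // => x _; rewrite K0 mul0mx.
have -> : \sum_x K (delta_mx x 0) *m K (delta_mx x 0) =
    E o *m hadamard (E w) (E o) *m E o.
  rewrite -sum_diag_idem mulmx_sumr !mulmx_suml; apply: eq_bigr => x _.
  by rewrite -colE !mulmxA -(mulmxA _ (E o) (E o)) idem_idem.
rewrite -mulmxA krein_mul -scalemxAr idem_idem => /eqP.
rewrite scaler_eq0 mulf_eq0 (negPf (idem_neq0 o)) orbF invr_eq0 (negPf order_neq0).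
rewrite orbF; apply/negP; apply: krein_near; by rewrite o1 w2.
Qed.
End Dickie.

(** * The numbers [a_i], [b_i], [c_i] as Krein parameters *)

Lemma qnE (a b c : 'I_d.+1) : qn q a b c = q a b c.
Proof. by rewrite /qn !inord_val. Qed.

Lemma astarE (i : 'I_d.+1) : astar q i = q o i i.
Proof. by rewrite /astar -o1 qnE. Qed.

Lemma bstarE (i j : 'I_d.+1) : i.+1 = j -> bstar q i = q o j i.
Proof.
by move=> ij; rewrite /bstar -o1 ij qnE; have := ltn_ord j; rewrite -ij ltnS => ->.
Qed.

Lemma cstarE (i j : 'I_d.+1) : j.+1 = i -> cstar q i = q o j i.
Proof. by move=> ij; rewrite /cstar -ij /= ij -o1 qnE. Qed.

Lemma star_sum (i : 'I_d.+1) : cstar q i + astar q i + bstar q i = mu o.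
Proof.
rewrite -(krein_sum o i) (bigID (fun j : 'I_d.+1 => j < i)%N) /=.
rewrite [X in _ = _ + X](bigID (fun j : 'I_d.+1 => val j == i)) /= -addrA.
congr (_ + (_ + _)).
- case: (posnP i) => [i0|i_gt0].
    rewrite /cstar i0 ltnn big_pred0 // => j; by rewrite ltn0.
  have i1 : (i.-1 < d.+1)%N by apply: leq_ltn_trans (ltn_ord i); apply: leq_pred.
  rewrite (bigD1 (Ordinal i1)) /=; last by rewrite prednK.
  rewrite big1 ?addr0 => [|j /andP[ji]]; first by apply: cstarE; rewrite /= prednK.
  by rewrite -val_eqE /= => ne; apply: krein1_far; lia.
- rewrite astarE (big_pred1 i) // => j; rewrite /= -val_eqE /=.
  by case: ltngtP.
have [id|di] := ltnP i d; last first.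
  rewrite /bstar ltnNge di big_pred0 // => j; apply/negbTE.
  by have := ltn_ord j; lia.
have i1 : (i.+1 < d.+1)%N by [].
rewrite (bigD1 (Ordinal i1)) /=; last by lia.
rewrite big1 ?addr0 => [|j /andP[ji]]; first exact: bstarE.
by rewrite -val_eqE /= => ne; apply: krein1_far; lia.
Qed.

(** * Q-antipodal schemes *)

Section Antipodal.
Local Notation D := (@ord_max d).
Hypothesis DD : forall h, q D D h != 0 -> h = ord0 \/ h = D.

(** After reassociation, the product of [E i] and [E j] involves only indices below [d], and [DD]
    leaves index 0 alone. *)
Lemma krein_DD (i j : 'I_d.+1) : (i + j < d)%N ->
  \sum_h q i D h * q j h D = (i == j)%:R * mu i.
Proof.
move=> ij.
have -> : \sum_h q i D h * q j h D = \sum_h q j i h * q h D D.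
  by rewrite krein_assoc.
rewrite (bigD1 ord0) //= big1 ?addr0 => [|h h0].
  by rewrite krein_idem0 eqxx mulr1 krein_at0 eq_sym; case: eqVneq => [->|_]; rewrite ?mul0r.
have [q0|qhD] := eqVneq (q h D D) 0; first by rewrite q0 mulr0.
have [h0'|->] : h = ord0 \/ h = D by apply: DD; rewrite krein_sym_eq0 kreinC.
  by rewrite h0' eqxx in h0.
by rewrite krein_far ?mul0r //= addnC ij.
Qed.

Lemma krein_D_orth (i j h : 'I_d.+1) : (i + j < d)%N -> i != j ->
  q i D h * q j D h = 0.
Proof.
move=> ij ne_ij; have := krein_DD i j ij; rewrite (negPf ne_ij) mul0r => /eqP.
rewrite psumr_eq0 => [|k _]; last by rewrite mulr_ge0 // krein_ge0.
move/allP/(_ h (mem_index_enum _)); rewrite mulf_eq0 [q j h D == 0]krein_sym_eq0.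
by rewrite -mulf_eq0 => /eqP.
Qed.

(** For [h > d - i], the index [d - h] already reaches [h] under multiplication by [E D], and
    [krein_D_orth] forbids a second one. *)
Lemma krein_D_supp (i h : 'I_d.+1) : (i.*2 < d)%N -> (h + i)%N != d -> q i D h = 0.
Proof.
move=> id hi; have [lt|le] := ltnP (h + i) d.
  by apply: krein_far; rewrite /=; lia.
have hd := ltn_ord h; have h'd : (d - h < d.+1)%N by lia.
have : q i D h * q (Ordinal h'd) D h = 0.
  by apply: krein_D_orth; rewrite -?val_eqE /=; lia.
move/eqP; rewrite mulf_eq0 => /orP[/eqP //|]; apply/contraTeq => _.
by apply: krein_near; rewrite /=; lia.
Qed.

Lemma krein_D_one (i h : 'I_d.+1) : (i.*2 < d)%N -> (h + i)%N = d -> q i D h = 1.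
Proof.
move=> id hi; have supp k : k != h -> q i D k = 0.
  by move=> kh; apply: krein_D_supp => //; move: kh; rewrite -val_eqE /=; lia.
have := krein_DD i i; rewrite addnn => /(_ id).
rewrite eqxx mul1r (bigD1 h) //= big1 ?addr0 => [|k kh]; last by rewrite supp ?mul0r.
have -> : q i h D = mu i.
  rewrite -(krein_sum i D) (bigD1 h) //= big1 ?addr0 // => k kh.
  by apply/eqP; rewrite krein_sym_eq0 supp.
by move/(canRL (mulfK (mu_neq0 i))); rewrite mulfV // mu_neq0.
Qed.

(** Multiplication by [E D] sends [i] to [d - i] with coefficient 1; the rest is associativity. *)
Lemma krein_D_shift (i i' l : 'I_d.+1) : (i.*2 < d)%N -> (i + i')%N = d ->
  \sum_h q o i h * q h D l = q o i' l.
Proof.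
move=> id ii'; rewrite krein_assoc (bigD1 i') //= big1 ?addr0 => [|h hi'].
  by rewrite krein_D_one ?mul1r // addnC.
by rewrite krein_D_supp ?mul0r //; move: hi'; rewrite -val_eqE /=; lia.
Qed.

Lemma antipodal_bc (i i' j l : 'I_d.+1) : (j.*2 < d)%N -> i.+1 = j ->
  (i + i')%N = d -> (j + l)%N = d -> q o i' l = q o i j.
Proof.
move=> jd ij ii' jl; rewrite -(krein_D_shift i i'); [|lia|by []].
rewrite (bigD1 j) //= krein_D_one ?mulr1 //; last by rewrite addnC.
rewrite big1 ?addr0 // => h; rewrite -val_eqE /= => hj.
have [ih|hi] := ltnP i.+1 h; first by rewrite krein1_far ?mul0r // ih.
by rewrite krein_D_supp ?mulr0 //; lia.
Qed.

Lemma antipodal_a (i i' : 'I_d.+1) : (i.*2.+1 < d)%N -> (i + i')%N = d ->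
  q o i i = q o i' i'.
Proof.
move=> id ii'; rewrite -(krein_D_shift i i'); [|lia|by []].
rewrite (bigD1 i) //= krein_D_one ?mulr1; [|lia|lia].
rewrite big1 ?addr0 // => h; rewrite -val_eqE /= => hi.
have [ih|hi'] := ltnP i.+1 h; first by rewrite krein1_far ?mul0r // ih.
(* For [h = i + 1] possibly [2 h = d], outside the range of [krein_D_supp]; orthogonality to the
   nonzero [q i D i'] still applies. *)
have /eqP : q i D i' * q h D i' = 0.
  by apply: krein_D_orth; rewrite -?val_eqE /=; lia.
rewrite mulf_eq0 krein_D_one ?oner_eq0 /=; [|lia|lia].
by move/eqP->; rewrite mulr0.
Qed.

Lemma antipodalP : Q_antipodal q.
Proof.
have upper (j l : 'I_d.+1) : (j.*2 < d)%N -> (j + l)%N = d -> bstar q l = cstar q j.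
  move=> jd jl; have [j0|j_gt0] := posnP j.
    have dl : (d <= l)%N by lia.
    by rewrite /bstar /cstar j0 ltnn ltnNge dl.
  have j'd : (j.-1 < d.+1)%N by have := ltn_ord j; lia.
  have l'd : (l.+1 < d.+1)%N by lia.
  rewrite (bstarE l (Ordinal l'd)) // (cstarE j (Ordinal j'd)) /= ?prednK //.
  by apply: antipodal_bc; rewrite /= ?prednK //; lia.
move=> i id ne_i; have [big_i|small_i] := ltnP d i.*2.
  have i1 : (i < d.+1)%N by []. have j1 : (d - i < d.+1)%N by lia.
  by apply: (upper (Ordinal j1) (Ordinal i1)); rewrite /=; lia.
have i1 : (i < d.+1)%N by []. have j1 : (d - i < d.+1)%N by lia.
(* Excluding [d./2] gives the range of [antipodal_a]; comparing the sums [c + a + b = m] at [i] and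
   [d - i] then yields [b_i]. *)
have i2 : (i.*2.+1 < d)%N by move: ne_i; lia.
have := star_sum (Ordinal i1); rewrite -(star_sum (Ordinal j1)) !astarE.
rewrite (antipodal_a _ (Ordinal j1)) /=; [|by []|lia].
rewrite -(upper (Ordinal i1) (Ordinal j1)) /=; [|lia|lia].
move=> e; apply: (addrI (bstar q (d - i) + q o (Ordinal j1) (Ordinal j1))).
by rewrite e; ring.
Qed.
End Antipodal.
(** * Closed subsets of idempotents *)

Section DualClosed.
Variable T : pred 'I_d.+1.
Hypothesis T_closed : forall i j h, T i -> T j -> q i j h != 0 -> T h.

Lemma dual_closed0 i : T i -> T ord0.
Proof.
move=> Ti; apply: (T_closed _ _ _ Ti Ti).
by rewrite krein_at0 eqxx mul1r mu_neq0.
Qed.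

Lemma dual_closed_first i : T o -> T i.
Proof.
move=> To; have [k] := ubnP i; elim: k i => // k IHk i ik.
have [i0|i_gt0] := posnP i.
  by have -> : i = ord0 by [apply: val_inj]; apply: dual_closed0 To.
have jd : (i.-1 < d.+1)%N by have := ltn_ord i; lia.
apply: (T_closed o (Ordinal jd)) => //; first by apply: IHk => /=; lia.
by apply: krein_near; rewrite o1 /=; lia.
Qed.

Hypothesis T_first : ~~ T o.

Lemma dual_closed_diag i : T i -> q i i o = 0.
Proof.
by move=> Ti; apply/eqP; apply: contraNT T_first; apply: T_closed.
Qed.

Lemma dual_closed_bipartite (w z : 'I_d.+1) :
  w = 2%N :> nat -> z = 3%N :> nat -> T w -> Q_bipartite q.
Proof.
move=> w2 z3 Tw.
have T_even (i : 'I_d.+1) : ~~ odd i -> T i.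
  have [k] := ubnP i; elim: k i => // k IHk i ik i_even.
  have [i0|i_gt0] := posnP i.
    by have -> : i = ord0 by [apply: val_inj]; apply: dual_closed0 Tw.
  have jd : (i.-2 < d.+1)%N by have := ltn_ord i; lia.
  apply: (T_closed w (Ordinal jd)) => //; first by apply: IHk => /=; lia.
  by apply: krein_near; rewrite w2 /=; lia.
have T_odd (i : 'I_d.+1) : odd i -> ~~ T i.
  move=> i_odd; apply: contra T_first => Ti.
  have jd : (i.-1 < d.+1)%N by have := ltn_ord i; lia.
  apply: (T_closed (Ordinal jd) i) => //; first by apply: T_even => /=; lia.
  by apply: krein_near; rewrite o1 /=; lia.
have a_even (i : 'I_d.+1) : ~~ odd i -> q o i i = 0.
  by move=> /T_even/dual_closed_diag q0; apply/eqP; rewrite kreinC krein_sym_eq0 q0.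
have a1 : q o o o = 0.
  apply/eqP/negPn/negP; apply: (dickie_absurd w z w2 z3).
  by apply: a_even; rewrite w2.
suff a0 (i : 'I_d.+1) : q o i i = 0.
  move=> i id; have i1 : (i < d.+1)%N by [].
  by rewrite (astarE (Ordinal i1)).
have [i_odd|] := boolP (odd i); last exact: a_even.
have [->//|i_neq1] := eqVneq i o.
have i3 : (2 < i)%N.
  by move: i_neq1 i_odd; rewrite -val_eqE /= o1; case: (val i) => [|[|[|]]].
have td : (i.-1 < d.+1)%N by have := ltn_ord i; lia.
pose t := Ordinal td.
(* The left side is zero: [E_1] squared involves only even indices, which with the even [t] cannot
   reach the odd [i]. The right side reduces to [c_i a_i]. *)
have := krein_assoc o o t i; rewrite big1 => [|h _]; last first.
  have [h2|h3] := ltnP 2 h; first by rewrite krein_far ?mul0r // o1 h2.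
  have [->|h_o] := eqVneq h o; first by rewrite a1 mul0r.
  suff -> : q h t i = 0 by rewrite mulr0.
  apply/eqP; apply: contraNT (T_odd i i_odd).
  apply: T_closed; apply: T_even => /=; last by lia.
  by move: h_o h3; rewrite -val_eqE /= o1; case: (val h) => [|[|[|]]].
rewrite (bigD1 i) //= big1 ?addr0 => [/esym/eqP|h].
  rewrite mulf_eq0 => /orP[|/eqP//]; apply/contraTeq => _.
  by apply: krein_near; rewrite o1 /=; lia.
rewrite -val_eqE /= => hi; have [->|ht] := eqVneq h t.
  by rewrite a_even ?mul0r //=; lia.
have [lt|le] := ltnP i h; first by rewrite krein1_far ?mul0r //=; lia.
rewrite [X in _ * X]krein1_far ?mulr0 //.
by move: ht; rewrite -val_eqE /=; lia.
Qed.

Lemma dual_closed_cases i : mu o != 1 -> mu o != 2 -> i != ord0 -> T i ->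
  Q_bipartite q \/ Q_antipodal q.
Proof.
move=> mu1 mu2 i0 Ti; have T0 : T ord0 by apply: dual_closed0 Ti.
have anti : (forall j, T j -> j = ord0 \/ j = ord_max) -> T ord_max -> Q_antipodal q.
  by move=> TD T_max; apply: antipodalP => h /(T_closed _ _ _ T_max T_max); apply: TD.
case: (pickP (fun w : 'I_d.+1 => (nat_of_ord w == 2%N) && T w)) =>
  [w /andP[/eqP w2 Tw]|no2].
  have [d3|d2] := ltnP 2 d.
    have d3' : (3 < d.+1)%N by [].
    by left; apply: (dual_closed_bipartite w (Ordinal d3')).
  (* For [d = 2], [T] is just [{0, d}]. *)
  have wd : w = ord_max by apply: val_inj; rewrite /= w2; have := ltn_ord w; lia.
  right; apply: anti; last by rewrite -wd.
  move=> j Tj; have jo : j != o by apply: contraNneq T_first => <-.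
  have := ltn_ord j; move: jo; rewrite -val_eqE /= o1 => j1 jd.
  have [j0|j_gt0] := posnP j; [left | right]; apply: val_inj => //=.
  by move: (ltn_ord w) w2 d2; rewrite wd /=; lia.
have T_max j : T j -> j = ord0 \/ j = ord_max.
  move=> Tj; have [->|j0] := eqVneq j ord0; [by left | right].
  apply/eqP/negPn/negP => jD.
  have j_gt0 : (0 < j)%N by rewrite lt0n.
  have sd : (j.-1 < d.+1)%N by have := ltn_ord j; lia.
  have rd : (j.+1 < d.+1)%N by move: jD (ltn_ord j); rewrite -val_eqE /=; lia.
  apply: (isometric_absurd j (Ordinal sd) (Ordinal rd)) => //=.
  - by rewrite prednK.
  - exact: dual_closed_diag.
  move=> w w2; apply/eqP/negPn/negP => /(T_closed _ _ _ Tj Tj) Tw.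
  by have := no2 w; rewrite w2 eqxx Tw.
right; apply: anti => //.
by have [i0'|<-//] := T_max i Ti; rewrite i0' eqxx in i0.
Qed.
End DualClosed.

(** Here [t = 3]: [c_3 + b_3 = m] gives [a_3 = 0]. Associativity of [E_1], [E_1], [E_3] at [E_3]
    reads [m + c_2 q_23^3 = b_2 c_3 + c_4 b_3 = m], so [q_33^2 = 0]. *)
Lemma exceptional_array_absurd (r : 'I_d.+1) : r = 4%N :> nat ->
  mu o != 1 -> mu o != 2 -> bstar q 2 = 1 -> cstar q 4 = 1 ->
  cstar q 3 = mu o - bstar q 3 -> False.
Proof.
move=> r4 mu1 mu2 b2 c4 c3.
have w_lt : (2 < d.+1)%N by have := ltn_ord r; lia.
have t_lt : (3 < d.+1)%N by have := ltn_ord r; lia.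
pose w := Ordinal w_lt; pose t := Ordinal t_lt.
have a3 : q o t t = 0.
  have := star_sum t; rewrite astarE c3 addrAC subrK.
  by move/(canRL (addKr _)); rewrite addNr.
have q_otw : q o t w = 1 by rewrite -(bstarE w).
have q_otr : q o t r = 1 by rewrite -(cstarE r) //= r4.
have q_mu : q o w t + q o r t = mu o.
  by rewrite -(cstarE t) // -(bstarE t r) //= c3 subrK.
have qwt : q w t t = 0.
  have := krein_assoc o o t t.
  have ow : o != w by rewrite -val_eqE /= o1.
  rewrite (bigD1 ord0) //= (bigD1 w) //= big1 ?addr0; last first.
    move=> h /andP[h0 hw]; have [->|ho] := eqVneq h o; first by rewrite a3 mulr0.
    rewrite krein1_far ?mul0r //; move: h0 hw ho; rewrite -!val_eqE /= o1 /w /=; lia.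
  rewrite krein_at0 krein_idem0 !eqxx mul1r mulr1.
  rewrite (bigD1 w) //= (bigD1 r) /=; last by rewrite -val_eqE /= r4.
  rewrite big1 ?addr0; last first.
    move=> h /andP[hw hr]; have [->|ht] := eqVneq h t; first by rewrite a3 mul0r.
    by rewrite krein1_far ?mul0r //; move: hw hr ht; rewrite -!val_eqE /= r4 /w /t /=; lia.
  rewrite q_otw q_otr !mul1r q_mu => /(canRL (addKr _)); rewrite addNr => /eqP.
  rewrite mulf_eq0 => /orP[|/eqP//]; apply/contraTeq => _.
  by apply: krein_near; rewrite o1.
apply: (isometric_absurd t w r) => //.
  by apply/eqP; rewrite krein_sym_eq0 kreinC a3.
move=> h h2; have -> : h = w by apply: val_inj.
by apply/eqP; rewrite krein_sym_eq0 kreinC qwt.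
Qed.
End FirstIdempotent.
End Cometric.
End Scheme.

Theorem theorem3p2 :
  (forall (n : nat) (rel : 'I_n -> 'I_n -> 'I_7) (E : 'I_7 -> 'M[algC]_n)
          (q : 'I_7 -> 'I_7 -> 'I_7 -> algC),
     sym_assoc_scheme rel -> imprimitive rel ->
     prim_idem_ordering rel E -> krein_params E q -> cometric q ->
     (2 < \rank (E (inord 1)))%N ->
     let m : algC := (\rank (E (inord 1)))%:R in
     ~ [/\ bstar q 0 = m, bstar q 1 = m - 1, bstar q 2 = 1,
           bstar q 5 = 1 &
           [/\ cstar q 1 = 1, cstar q 3 = m - bstar q 3, cstar q 4 = 1,
               cstar q 6 = m &
               astar q 2 = astar q 4 + astar q 5]])
  /\
  (forall (n d : nat) (rel : 'I_n -> 'I_n -> 'I_(d.+1))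
          (E : 'I_(d.+1) -> 'M[algC]_n)
          (q : 'I_(d.+1) -> 'I_(d.+1) -> 'I_(d.+1) -> algC),
     sym_assoc_scheme rel -> imprimitive rel ->
     prim_idem_ordering rel E -> krein_params E q -> cometric q ->
     (2 < \rank (E (inord 1)))%N ->
     Q_bipartite q \/ Q_antipodal q).
Proof.
have rank_gt2 k : (2 < k)%N -> k%:R != 1 :> algC /\ k%:R != 2 :> algC.
  by rewrite -[1]/1%:R !eqr_nat; case: k => [|[|[|]]].
split=> [n rel E q sch _ ord kr com rk m | n d rel E q sch imp ord kr com rk].
  case=> _ _ b2 _ [_ c3 c4 _ _]; have [mu1 mu2] := rank_gt2 _ rk.
  have muE := mu_rank _ _ _ _ ord (inord 1).
  apply: (exceptional_array_absurd _ _ _ _ _ sch ord kr com (inord 1) _ (inord 4));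
    rewrite ?muE ?inordK //.
have [i [i0 [x [y xy]]]] := imp.
have d_gt0 : (1 < d.+1)%N by have := ltn_ord i; move: i0; rewrite -val_eqE /=; lia.
have o1 : (inord 1 : 'I_d.+1) = 1%N :> nat by rewrite inordK.
have [mu1 mu2] := rank_gt2 _ rk.
have [j j0 Tj] := component_idem_nontrivial _ _ _ _ sch ord i x y xy.
have T_closed := component_idem_closed _ _ _ _ _ sch ord kr i.
apply: (dual_closed_cases _ _ _ _ _ sch ord kr com _ o1 _ T_closed _ j) => //.
- apply/negP => To; apply: (component_idem_proper _ _ _ _ sch ord i i0) => k.
  exact: (dual_closed_first _ _ _ _ _ sch ord kr com _ o1 _ T_closed).
- by rewrite (mu_rank _ _ _ _ ord).
- by rewrite (mu_rank _ _ _ _ ord).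
Qed.
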